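(* Let $K$ be a field of characteristic zero, $R=K[x_1,\ldots,x_n]$, and let $h=(1,n,h_2,h_3,\ldots,h_c)$ be an O-sequence. The following four conditions are equivalent: (i) $h$ is the Hilbert function of $R/I$ for some almost revlex ideal $I$ of $R$; (ii) $h$ is the Hilbert function of some graded Artinian $K$-algebra with the $n$-SLP; (iii) $h$ is the Hilbert function of some graded Artinian $K$-algebra with the $n$-WLP; (iv) $h$ is a unimodal O-sequence, and $\Delta^kh$ is a unimodal O-sequence for every integer $k$ with $1\le k\le n$.
   Context: Graded $K$-algebras are standard graded: quotients of a polynomial ring over $K$ (variables in degree 1) by a homogeneous ideal; Artinian means finite-dimensional over $K$. The Hilbert function of $A=\bigoplus_iA_i$ is $t\mapsto\dim_KA_t$, identified with a finite sequence $(h_0,\ldots,h_c)$ of positive integers (trailing zeros omitted, $h_j=0$ for $j>c$ and $j<0$). An O-sequence is a sequence that is the Hilbert function of some graded $K$-algebra. SLP/WLP: for $\ell\in A_1$, $(A,\ell)$ has the SLP (resp. WLP) if the map $\times\ell^s:A_i\to A_{i+s}$ has full rank (is injective or surjective) for every $i\ge0$ and every $s>0$ (resp. for $s=1$). $A$ has the $k$-SLP (resp. $k$-WLP) if there are $g_1,\ldots,g_k\in A_1$ such that $(A,g_1)$ has the SLP (resp. WLP) and $(A/(g_1,\ldots,g_{i-1}),g_i)$ has the SLP (resp. WLP) for all $i=2,\ldots,k$. Difference: $(\Delta h)_i=\max\{h_i-h_{i-1},0\}$ for $i\ge0$ with $h_{-1}=0$; $\Delta^k$ is $\Delta$ applied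 $k$ times. Unimodal: there is $i\ge0$ such that $h_0<h_1<\cdots<h_i$ and $h_i\ge h_{i+1}\ge\cdots$. Graded reverse lexicographic order $>_{\text{revlex}}$ (with $x_1>\cdots>x_n$): $x^a>_{\text{revlex}}x^b$ if $\deg x^a>\deg x^b$, or the degrees are equal and the last nonzero entry of $a-b$ is negative. Almost revlex ideal: a monomial ideal $I$ such that for each monomial $u$ in the minimal generating set of $I$, every monomial $v$ with $\deg v=\deg u$ and $v>_{\text{revlex}}u$ belongs to $I$. *)

(* Defs.v *)
From mathcomp Require Export all_boot all_order all_algebra.
From mathcomp Require Export mpoly.

Set Implicit Arguments.
Unset Strict Implicit.
Unset Printing Implicit Defensive.

Import GRing.Theory.

Local Open Scope ring_scope.

(* A graded K-algebra A = K[x_1, ..., x_m] / I is represented by its ideal I,  *)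
(* a Prop-valued predicate on {mpoly K[m]} (a {pred _}, as in ring_quotient,   *)
(* would demand decidable membership, which sums of ideals do not inherit      *)
(* constructively).  An element of A is given by a polynomial representing it, *)
(* and u = v in A reads I (u - v); an element of A_t is represented by a form  *)
(* of degree t, since I is homogeneous.                                        *)
Section Algebras.
Variables (K : fieldType) (m : nat).
Implicit Types (I S : {mpoly K[m]} -> Prop).

Definition is_ideal I : Prop :=
  I 0 /\ forall a p q, I p -> I q -> I (a * p + q).

Definition homogeneous_ideal I : Prop :=
  is_ideal I /\ forall p d, I p -> I (pihomog mdeg d p).

Definition ideal_gen S (p : {mpoly K[m]}) : Prop :=
  exists (r : nat) (a g : 'I_r -> {mpoly K[m]}),
    (forall i, S (g i)) /\ p = \sum_i a i * g i.

(* The image of the subspace V in A has dimension d: it has a basis, namely    *)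
(* the classes of e_0, ..., e_(d-1).                                           *)
Definition dim_mod I (V : {mpoly K[m]} -> Prop) (d : nat) : Prop :=
  exists e : 'I_d -> {mpoly K[m]},
    (forall i, V (e i)) /\
    forall p, V p -> exists! c : 'rV[K]_d, I (p - \sum_i c 0 i *: e i).

Definition hilbert_function I (h : nat -> nat) : Prop :=
  forall t, dim_mod I (fun p => p \is t.-homog) (h t).

Definition artinian I : Prop := exists d, dim_mod I (fun=> True) d.

(* Multiplication by l ^+ s from A_i to A_(i + s) is injective or surjective.  *)
Definition mul_full_rank I (l : {mpoly K[m]}) (s i : nat) : Prop :=
  (forall p, p \is i.-homog -> I (l ^+ s * p) -> I p) \/
  (forall q, q \is (i + s).-homog ->
     exists2 p, p \is i.-homog & I (q - l ^+ s * p)).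

Definition SLP I (l : {mpoly K[m]}) : Prop :=
  forall i s, (0 < s)%N -> mul_full_rank I l s i.

Definition WLP I (l : {mpoly K[m]}) : Prop :=
  forall i, mul_full_rank I l 1 i.

(* The ideal of K[x_1, ..., x_m] whose quotient is A / (g_0, ..., g_(i-1)).    *)
Definition add_gens I k (g : 'I_k -> {mpoly K[m]}) (i : nat) :
    {mpoly K[m]} -> Prop :=
  ideal_gen (fun p => I p \/ exists2 j : 'I_k, (j < i)%N & p = g j).

Definition k_SLP (k : nat) I : Prop :=
  exists g : 'I_k -> {mpoly K[m]}, forall i : 'I_k,
    g i \is 1.-homog /\ SLP (add_gens I g i) (g i).

Definition k_WLP (k : nat) I : Prop :=
  exists g : 'I_k -> {mpoly K[m]}, forall i : 'I_k,
    g i \is 1.-homog /\ WLP (add_gens I g i) (g i).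

(* x^a >_revlex x^b.  The order (_ < _)%O on 'X_{1..m} is not this one: it    *)
(* compares the degrees and then the exponents lexicographically.              *)
Definition revlex_gt (a b : 'X_{1..m}) : Prop :=
  (mdeg b < mdeg a)%N \/
  (mdeg a = mdeg b /\
   exists i : 'I_m, (a i < b i)%N /\ forall j : 'I_m, (i < j)%N -> a j = b j).

Definition generated_by_monomials (G : 'X_{1..m} -> Prop) I : Prop :=
  forall p, I p <-> ideal_gen (fun q => exists2 u, G u & q = 'X_[u]) p.

Definition minimal_monomial_gens (G : 'X_{1..m} -> Prop) I : Prop :=
  generated_by_monomials G I /\
  forall G' : 'X_{1..m} -> Prop, (forall u, G' u -> G u) ->
    generated_by_monomials G' I -> forall u, G u -> G' u.

(* Every monomial ideal has exactly one minimal monomial generating set, so    *)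
(* the existential is only a way to name it.                                   *)
Definition almost_revlex I : Prop :=
  exists2 G, minimal_monomial_gens G I &
    forall u v, G u -> mdeg v = mdeg u -> revlex_gt v u -> I 'X_[v].

End Algebras.

Definition O_sequence (K : fieldType) (h : nat -> nat) : Prop :=
  exists (m : nat) (I : {mpoly K[m]} -> Prop),
    homogeneous_ideal I /\ hilbert_function I h.

(* Truncated subtraction is max {h_i - h_(i-1), 0}.                            *)
Definition Delta (h : nat -> nat) (i : nat) : nat :=
  if i is j.+1 then (h j.+1 - h j)%N else h 0%N.

Definition unimodal (h : nat -> nat) : Prop :=
  exists i : nat, (forall j, (j < i)%N -> (h j < h j.+1)%N) /\
                  (forall j, (i <= j)%N -> (h j.+1 <= h j)%N).

(* Main.v *)
(* (i) => (ii): if I is almost revlex, u is not in J = I + (x_(k+1), ..., x_n) *)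
(* and x_k^s u is, then a minimal generator w of I divides x_k^s u and has      *)
(* x_k-exponent larger than u.  Every monomial v of degree deg u + s with       *)
(* v_k < s in the remaining variables then has a divisor of degree deg w that   *)
(* is revlex-larger than w, so v is in I; hence x_k^s is onto.  So x_n, ...,    *)
(* x_1 witness the n-SLP.                                                       *)
(* (iii) => (iv): if (A, l) has the WLP then A/(l) has Hilbert function Delta h,*)
(* and once Delta h vanishes it stays 0, so h is unimodal.                      *)
(* (iv) => (i): the standard monomials are built one variable at a time.  Let M *)
(* be those in x_1, ..., x_k, with Hilbert function Delta f, ranked by the      *)
(* graded revlex order.  The monomials u x_(k+1)^a with u in M and              *)
(* rank u < f (deg u + a) then have Hilbert function f, and unimodality of f    *)
(* makes them the complement of an almost revlex ideal.                         *)
Require Import Defs.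
From Stdlib Require Import Classical.
From mathcomp Require Import zify.

Set Implicit Arguments.
Unset Strict Implicit.
Unset Printing Implicit Defensive.

(** The conditions meet in the passage from [h] to [Delta h]. For a linear form with the WLP,
    multiplication from degree t to t+1 has rank min(h_t, h_(t+1)), so the quotient by it has
    Hilbert function [Delta h] ([hilbert_add_gen]). By iteration every Delta^k h with k <= n is the
    Hilbert function of a quotient, and a graded quotient that vanishes in one degree vanishes in
    all later ones; this yields unimodality ([WLP_unimodal], [k_WLP_unimodal]). Conversely, [extend]
    undoes one difference by adding a variable. Given standard monomials [M] for [Delta f], each
    member of degree at most d has exactly one multiple of degree d by a power of the new variable;
    there are at least f_d of these, and the revlex-smallest f_d are kept. From Delta^n h = (1, 0,
    ...), n such steps lead to the ideal ([exists_standard_set], [nonstandard_almost_revlex]).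
    Almost revlex ideals have the n-SLP because, in a given degree, a power of the current last
    variable either kills no standard monomial or reaches all of them ([mono_mul_full_rank],
    [almost_revlex_full]). The WLP is the case s = 1. *)

Lemma count_lt_inj (T : eqType) (s : seq T) (r : T -> nat) f :
  uniq s -> {in s &, injective r} -> {in s, forall x, r x < size s} ->
  count (fun x => r x < f) s = minn f (size s).
Proof.
move=> us r_inj r_lt; rewrite -(count_map r (fun i => i < f)).
have u_rs : uniq (map r s) by rewrite map_inj_in_uniq.
have sub_rs : {subset map r s <= iota 0 (size s)}.
  by move=> _ /mapP[x xs ->]; rewrite mem_iota /= r_lt.
have [|_ eq_rs] := uniq_min_size u_rs sub_rs; first by rewrite size_iota size_map.
(* Distinct values below [size s], as many as there are such integers, exhaust them. *)
have /permP-> : perm_eq (map r s) (iota 0 (size s)).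
  exact: uniq_perm u_rs (iota_uniq _ _) eq_rs.
rewrite -size_filter; elim: (size s) => [|k IH]; first by rewrite minn0.
by rewrite -addn1 iotaD filter_cat size_cat IH /= add0n; case: ltnP => /=; lia.
Qed.

Lemma count_lt (T : eqType) (P Q : pred T) (s : seq T) x :
  (forall y, P y -> Q y) -> x \in s -> Q x -> ~~ P x -> count P s < count Q s.
Proof.
move=> PQ xs Qx nPx; elim: s xs => [//|y s IH] /=.
rewrite inE => /orP[/eqP<-|/IH lt_s].
  by rewrite Qx (negPf nPx) add0n add1n ltnS; apply: sub_count.
by rewrite -addnS leq_add //; case: (boolP (P y)) => // /PQ->.
Qed.

(** * Monomials under the graded reverse lexicographic order, and ranks *)

Section Monomials.
Variable n : nat.
Implicit Types (u v w : 'X_{1..n}) (M : pred 'X_{1..n}).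

(** Zeroing exponents, rather than changing the number of variables, keeps all stages of the
    construction in one type of monomials. *)
Definition mtrunc k u : 'X_{1..n} := [multinom if i < k then u i else 0 | i < n].

(** The decidable form of [revlex_gt], with the arguments swapped, as counting requires. *)
Definition revlex_lt u v : bool :=
  (mdeg u < mdeg v) ||
  (mdeg u == mdeg v) &&
    [exists i : 'I_n, (v i < u i) && [forall j : 'I_n, (i < j) ==> (u j == v j)]].

Lemma revlex_ltP u v : reflect (revlex_gt v u) (revlex_lt u v).
Proof.
apply: (iffP orP) => [[|/andP[/eqP duv /existsP[i /andP[vu /forallP eq_above]]]]|].
- by left.
- right; split=> //; exists i; split=> // j ij.
  by have := eq_above j; rewrite ij => /eqP.
case=> [|[dvu [i [vu eq_above]]]]; [by left | right].
rewrite dvu eqxx; apply/existsP; exists i; rewrite vu /=.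
by apply/forallP => j; apply/implyP => /eq_above->.
Qed.

Lemma revlex_lt_mdeg u v : revlex_lt u v -> mdeg u <= mdeg v.
Proof. by case/orP => [/ltnW//|/andP[/eqP->]]. Qed.

Lemma revlex_lt_irr u : revlex_lt u u = false.
Proof.
rewrite /revlex_lt ltnn eqxx; apply/existsP => -[i /andP[]].
by rewrite ltnn.
Qed.

Lemma revlex_lt_trans : transitive revlex_lt.
Proof.
move=> v u w /revlex_ltP[duv|[duv [i [vi eq_i]]]]
  /revlex_ltP[dvw|[dvw [j [wj eq_j]]]];
  apply/revlex_ltP; [left; lia | left; lia | left; lia | right; split; first lia].
have [lt_ij|lt_ji|/val_inj eq_ij] := ltngtP i j.
- exists j; split=> [|l jl]; first by rewrite -eq_i.
  by rewrite eq_j // eq_i // (ltn_trans lt_ij).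
- exists i; split=> [|l il]; first by rewrite eq_j.
  by rewrite eq_j ?eq_i // (ltn_trans lt_ji).
exists j; split=> [|l jl]; first by rewrite (ltn_trans wj) // -eq_ij.
by rewrite eq_j ?eq_i // eq_ij.
Qed.

Lemma revlex_lt_total u v : u != v -> revlex_lt u v || revlex_lt v u.
Proof.
move=> ne_uv; have [lt_uv|lt_vu|eq_uv] := ltngtP (mdeg u) (mdeg v).
- by rewrite /revlex_lt lt_uv.
- by rewrite /revlex_lt lt_vu orbT.
have [i0 ne_i0] : exists i, u i != v i.
  apply/existsP; apply: contraNT ne_uv => /existsPn eq_uv'.
  by apply/eqP/mnmP => i; apply/eqP/negPn/eq_uv'.
(* The last position where the exponents differ decides the comparison. *)
have [i ne_i max_i] := @arg_maxnP _ i0 (fun i => u i != v i) val ne_i0.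
have eq_above (j : 'I_n) : i < j -> u j = v j.
  by move=> ij; apply: contraTeq ij => /max_i; rewrite -leqNgt.
apply/orP; move: ne_i; rewrite neq_ltn => /orP[lt_i|lt_i]; [right|left];
  by apply/revlex_ltP; right; split=> //; exists i; split=> // j /eq_above.
Qed.

Definition mons d : seq 'X_{1..n} := [seq val w | w : 'X_{1..n < d.+1}].

Lemma mem_mons d u : (u \in mons d) = (mdeg u <= d).
Proof.
apply/mapP/idP => [[w _ ->]|du]; first by rewrite -ltnS; apply: (bmdeg w).
by have du' : mdeg u < d.+1 by []; exists (BMultinom du'); rewrite ?mem_enum.
Qed.

Lemma mons_uniq d : uniq (mons d).
Proof. by rewrite map_inj_uniq ?enum_uniq //; apply: val_inj. Qed.

Lemma count_mons d d' (P : pred 'X_{1..n}) :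
  (forall u, P u -> mdeg u <= d) -> (forall u, P u -> mdeg u <= d') ->
  count P (mons d) = count P (mons d').
Proof.
move=> Pd Pd'; rewrite -!size_filter; apply/perm_size/uniq_perm.
- exact/filter_uniq/mons_uniq.
- exact/filter_uniq/mons_uniq.
move=> u; rewrite !mem_filter !mem_mons.
by have [Pu|//] := boolP (P u); rewrite Pd ?Pd'.
Qed.

Lemma count_monsS d M : count M (mons d.+1) =
  count M (mons d) + count (fun u => M u && (mdeg u == d.+1)) (mons d.+1).
Proof.
rewrite -!size_filter -size_cat; apply/perm_size/uniq_perm.
- exact/filter_uniq/mons_uniq.
- rewrite cat_uniq !filter_uniq ?mons_uniq // andbT; apply/hasPn => u.
  by rewrite !mem_filter !mem_mons => /andP[/andP[_ /eqP->]]; rewrite ltnn andbF.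
move=> u; rewrite mem_cat !mem_filter !mem_mons leq_eqVlt ltnS.
by case: (M u); case: (ltngtP (mdeg u) d.+1) => //=; lia.
Qed.

(* The rank of (u, a) among the u' x_k^a' of its degree with u' in M does not *)
(* depend on a, since a smaller x_k-exponent makes a monomial larger.         *)
Definition rank M u := count (fun w => M w && revlex_lt w u) (mons (mdeg u)).

Lemma rankE M u d : mdeg u <= d ->
  rank M u = count (fun w => M w && revlex_lt w u) (mons d).
Proof.
move=> ud; apply: count_mons => w /andP[_ /revlex_lt_mdeg] // wu.
exact: leq_trans wu ud.
Qed.

Lemma rank_lt M u d : M u -> mdeg u <= d -> rank M u < count M (mons d).
Proof.
move=> Mu ud; rewrite (rankE _ ud); apply: (@count_lt _ _ _ _ u) => //.
- by move=> w /andP[].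
- by rewrite mem_mons.
by rewrite revlex_lt_irr andbF.
Qed.

Lemma leq_rank M u v : revlex_lt u v -> rank M u <= rank M v.
Proof.
move=> uv; rewrite (rankE _ (revlex_lt_mdeg uv)).
apply: sub_count => w /andP[-> wu] /=.
exact: revlex_lt_trans uv.
Qed.

Lemma ltn_rank M u v : M u -> revlex_lt u v -> rank M u < rank M v.
Proof.
move=> Mu uv; rewrite (rankE _ (revlex_lt_mdeg uv)).
apply: (@count_lt _ _ _ _ u) => //.
- by move=> w /andP[-> wu] /=; apply: revlex_lt_trans uv.
- by rewrite mem_mons revlex_lt_mdeg.
- by rewrite Mu.
by rewrite revlex_lt_irr andbF.
Qed.

Lemma rank_inj M : {in M &, injective (rank M)}.
Proof.
move=> u v Mu Mv eq_uv; apply: contraTeq isT.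
by case/revlex_lt_total/orP => [/(ltn_rank Mu)|/(ltn_rank Mv)]; rewrite eq_uv ltnn.
Qed.

(** The order is total, so the ranks of the members of degree at most [d] are distinct; being
    smaller than the number of these members, they fill an initial segment of the integers. *)
Lemma count_rank_lt M d f :
  count (fun u => M u && (rank M u < f)) (mons d) = minn f (count M (mons d)).
Proof.
rewrite -(size_filter M) -(@count_lt_inj _ _ (rank M)).
- by rewrite count_filter; apply: eq_count => u /=; rewrite andbC.
- exact/filter_uniq/mons_uniq.
- by move=> u v; rewrite !mem_filter => /andP[Mu _] /andP[Mv _]; apply: rank_inj.
by move=> u; rewrite mem_filter mem_mons size_filter => /andP[]; apply: rank_lt.
Qed.

End Monomials.

(** * Iterated differences *)

Lemma iter_Delta_eq0 (h : nat -> nat) z k :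
  (forall j, z <= j -> h j = 0) -> forall j, (z <= j) -> iter k Delta h j = 0.
Proof.
move=> hz; elim: k => [//|k IH] [|j] zj /=; first exact: IH.
by rewrite IH.
Qed.

Lemma iter_Delta0 (h : nat -> nat) k : iter k Delta h 0 = h 0.
Proof. by elim: k. Qed.

Lemma iter_Delta1 (h : nat -> nat) k :
  h 0 = 1 -> iter k Delta h 1 = (h 1 - k).
Proof.
move=> h0; elim: k => [|k IH] /=; first by rewrite subn0.
by rewrite IH iter_Delta0 h0; lia.
Qed.

(** * Standard monomials, built one variable at a time *)

Section StandardMonomials.
Variable n : nat.
Implicit Types (u v w : 'X_{1..n}) (M : pred 'X_{1..n}) (f g h : nat -> nat).

Lemma mtruncE k u i : mtrunc k u i = if i < k then u i else 0.
Proof. by rewrite mnmE. Qed.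

Lemma mtrunc_n u : mtrunc n u = u.
Proof. by apply/mnmP => i; rewrite mtruncE ltn_ord. Qed.

Lemma mtrunc_idP k u :
  reflect (forall i : 'I_n, k <= i -> u i = 0) (mtrunc k u == u).
Proof.
apply: (iffP eqP) => [<- i ki|u0]; first by rewrite mtruncE ltnNge ki.
by apply/mnmP => i; rewrite mtruncE; case: ltnP => // /u0.
Qed.

Lemma mtruncS (k : 'I_n) u :
  mtrunc k.+1 u == u -> u = (mtrunc k u + U_(k) *+ u k)%MM.
Proof.
move/mtrunc_idP=> u0; apply/mnmP => i.
rewrite mnmDE mtruncE mulmnE mnm1E -val_eqE /=; case: (ltngtP i k) => [||/val_inj->].
- by move=> _; rewrite addn0.
- by move=> /u0->.
by rewrite mul1n.
Qed.

Lemma mdeg_mtrunc (k : 'I_n) u :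
  mtrunc k.+1 u == u -> mdeg u = mdeg (mtrunc k u) + u k.
Proof. by move=> /mtruncS {1}->; rewrite mdegD mdegMn mdeg1 mul1n. Qed.

Lemma mdeg_gt0_var u : 0 < mdeg u -> exists i, u i != 0.
Proof.
rewrite lt0n => u_neq0; apply/existsP; apply: contraNT u_neq0 => /existsPn u0.
by rewrite mdeg_eq0; apply/eqP/mnmP => i; rewrite mnm0E; apply/eqP/negPn/u0.
Qed.

(** The sum telescopes, and truncating negative differences can only increase it. *)
Lemma leq_sum_Delta f d : f d <= \sum_(i < d.+1) Delta f i.
Proof.
elim: d => [|d IH]; first by rewrite big_ord1.
by rewrite big_ord_recr /=; apply: leq_trans (leq_add IH (leqnn _)); lia.
Qed.

Lemma sum_Delta f d : (forall i, i < d -> f i <= f i.+1) ->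
  \sum_(i < d.+1) Delta f i = f d.
Proof.
elim: d => [|d IH] incr; first by rewrite big_ord1.
rewrite big_ord_recr /= IH => [|i id]; last by apply: incr; apply: ltnW.
by have := incr d (ltnSn d); lia.
Qed.

(* M is the set of standard monomials of an almost revlex ideal in the first k *)
(* variables; std_revlex is the contrapositive of the condition on generators.  *)
Record standard_set k M g : Prop := StandardSet {
  std_supp : forall u, M u -> mtrunc k u = u;
  std_divisor : forall u i, M (u + U_(i))%MM -> M u;
  std_revlex : forall u v, M v -> mtrunc k u = u -> mdeg u = mdeg v ->
    revlex_lt u v -> (forall w i, u = (w + U_(i))%MM -> M w) -> M u;
  std_hilbert : forall d, count (fun u => M u && (mdeg u == d)) (mons n d) = g d
}.

Lemma count_standard k M g d : standard_set k M g ->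
  count M (mons n d) = \sum_(i < d.+1) g i.
Proof.
move=> stM; elim: d => [|d IH]; last first.
  by rewrite count_monsS IH [RHS]big_ord_recr /= (std_hilbert stM).
rewrite big_ord1 -(std_hilbert stM); apply: eq_in_count => u.
by rewrite mem_mons leqn0 => ->; rewrite andbT.
Qed.

Definition extend k M f : pred 'X_{1..n} := fun u =>
  [&& mtrunc k.+1 u == u, M (mtrunc k u) & rank M (mtrunc k u) < f (mdeg u)].

Section Extend.
Variables (k : 'I_n) (M : pred 'X_{1..n}) (f : nat -> nat).
Hypotheses (stM : standard_set k M (Delta f)) (f_unimodal : unimodal f).

(** Unimodality enters here. From the peak on, f_(d+1) <= f_d. Before it, f_d is the number of all
    members of [M] of degree at most [d], which exceeds the rank of any of them. *)
Lemma rank_ltS u d : M u -> mdeg u <= d -> rank M u < f d.+1 -> rank M u < f d.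
Proof.
move=> Mu ud lt_f; have [p [incr decr]] := f_unimodal.
have [pd|dp] := leqP p d; first exact: leq_trans lt_f (decr _ pd).
rewrite -[f d]sum_Delta; last by move=> i id; apply/ltnW/incr/(ltn_trans id).
by rewrite -(count_standard _ stM); apply: rank_lt.
Qed.

Lemma extend_divisor u i : extend k M f (u + U_(i))%MM -> extend k M f u.
Proof.
case/and3P=> /mtrunc_idP ui0 Mui lt_f.
have uT : mtrunc k.+1 u == u.
  by apply/mtrunc_idP => j /ui0; rewrite mnmDE; lia.
have dui : mdeg (u + U_(i))%MM = (mdeg u).+1 by rewrite mdegD mdeg1 addn1.
have du : mdeg (mtrunc k u) <= mdeg u by rewrite [leqRHS](mdeg_mtrunc uT) leq_addr.
have [Mu le_rank] : M (mtrunc k u) /\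
    rank M (mtrunc k u) <= rank M (mtrunc k (u + U_(i))%MM).
  (* Dividing by the new variable leaves the truncation unchanged; dividing by an earlier one
     divides the truncation and so lowers its rank weakly. *)
  have [ik|ki] := ltnP i k; last first.
    suff <- : mtrunc k (u + U_(i))%MM = mtrunc k u by [].
    apply/mnmP => j; rewrite !mtruncE; case: ltnP => // jk.
    by rewrite mnmDE mnm1E -val_eqE /= gtn_eqF ?addn0 // (leq_trans jk).
  have E : mtrunc k (u + U_(i))%MM = (mtrunc k u + U_(i))%MM.
    apply/mnmP => j; rewrite mnmDE !mtruncE mnmDE; case: ltnP => // kj.
    by rewrite mnm1E -val_eqE /= ltn_eqF // (leq_trans ik).
  rewrite E in Mui *; split; first exact: (std_divisor stM) Mui.
  by apply: leq_rank; rewrite /revlex_lt mdegD mdeg1 addn1 leqnn.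
apply/and3P; split=> //; apply: rank_ltS => //.
by rewrite -dui; apply: leq_ltn_trans lt_f.
Qed.

(** If the deciding position is [k], then [u] has the larger exponent there, hence a truncation of
    smaller degree. If it lies before [k], the exponents at [k] agree and the comparison passes to
    the truncations. *)
Lemma revlex_lt_mtrunc u v : mtrunc k.+1 u == u -> mtrunc k.+1 v == v ->
  mdeg u = mdeg v -> revlex_lt u v ->
  v k <= u k /\ revlex_lt (mtrunc k u) (mtrunc k v).
Proof.
move=> uT vT duv /revlex_ltP[|[_ [i [vu eq_above]]]]; first by rewrite duv ltnn.
have := duv; rewrite (mdeg_mtrunc uT) (mdeg_mtrunc vT) => dT.
have ik : i <= k.
  rewrite leqNgt; apply/negP => ki; move/mtrunc_idP: uT => /(_ i ki) u0.
  by rewrite u0 in vu.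
move: ik; rewrite leq_eqVlt => /orP[/eqP/val_inj ik|ik].
  rewrite ik in vu; split; first exact: ltnW.
  by rewrite /revlex_lt (_ : mdeg (mtrunc k u) < _) //; lia.
have eq_k := eq_above _ ik; rewrite eq_k; split=> //.
apply/revlex_ltP; right; split; first by lia.
exists i; rewrite !mtruncE ik; split=> // j /eq_above eq_j.
by rewrite !mtruncE eq_j.
Qed.

Lemma extend_revlex u v : extend k M f v -> mtrunc k.+1 u = u ->
  mdeg u = mdeg v -> revlex_lt u v ->
  (forall w i, u = (w + U_(i))%MM -> extend k M f w) -> extend k M f u.
Proof.
case/and3P=> vT Mv lt_f /eqP uT duv uv div_u.
have [vk_uk uvT] := revlex_lt_mtrunc uT vT duv uv.
suff Mu : M (mtrunc k u).
  by apply/and3P; split=> //; rewrite duv;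
     apply: leq_ltn_trans lt_f; apply: leq_rank.
(* If the new variable divides [u], the quotient is standard and has the same truncation. Otherwise
   it divides neither [u] nor [v], and the property of [M] applies. *)
have [uk0|uk] := posnP (u k); last first.
  have le_ku : (U_(k) <= u)%MM by rewrite lep1mP -lt0n.
  have /and3P[_ Mw _] := div_u _ _ (esym (submK le_ku)).
  suff <- : mtrunc k (u - U_(k))%MM = mtrunc k u by [].
  apply/mnmP => j; rewrite !mtruncE; case: ltnP => // jk.
  by rewrite mnmBE mnm1E -val_eqE /= gtn_eqF ?subn0.
have vk0 : v k = 0 by apply/eqP; rewrite -leqn0 -uk0.
have Eu : mtrunc k u = u by rewrite {2}(mtruncS uT) uk0 mulm0n addm0.
have Ev : mtrunc k v = v by rewrite {2}(mtruncS vT) vk0 mulm0n addm0.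
rewrite Ev in Mv; rewrite Eu; apply: (std_revlex stM Mv Eu duv uv) => w i uw.
have /and3P[_ Mw _] := div_u _ _ uw; suff <- : mtrunc k w = w by [].
apply/eqP/mtrunc_idP => j kj; move/eqP/mtrunc_idP: Eu => /(_ j kj).
by rewrite uw mnmDE; lia.
Qed.

(** Truncation is a bijection from the degree [d] part onto the members of [M] of degree at most [d]
    and rank below f_d. Since [M] has at least f_d members in these degrees, exactly f_d remain. *)
Lemma count_extend d :
  count (fun u => extend k M f u && (mdeg u == d)) (mons n d) = f d.
Proof.
transitivity (count (fun u => M u && (rank M u < f d)) (mons n d)); last first.
  rewrite count_rank_lt (count_standard _ stM); apply/minn_idPl.
  exact: leq_sum_Delta.
rewrite -!size_filter -(size_map (mtrunc k)); apply/perm_size/uniq_perm.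
- rewrite map_inj_in_uniq ?filter_uniq ?mons_uniq // => u v.
  rewrite !mem_filter => /andP[/andP[/and3P[uT _ _] /eqP du] _].
  move=> /andP[/andP[/and3P[vT _ _] /eqP dv] _] eqT.
  rewrite (mtruncS uT) (mtruncS vT) eqT; congr (_ + _ *+ _)%MM.
  by move: du dv; rewrite (mdeg_mtrunc uT) (mdeg_mtrunc vT) eqT; lia.
- exact/filter_uniq/mons_uniq.
move=> w; rewrite mem_filter mem_mons; apply/mapP/andP => [[u]|[/andP[Mw lt_f] dw]].
  rewrite mem_filter => /andP[/andP[/and3P[uT Mu lt_f] /eqP du] _] ->.
  by rewrite Mu -{1}du lt_f -du [leqRHS](mdeg_mtrunc uT) leq_addr.
(* The preimage of [w] is filled up to degree [d] with the new variable. *)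
pose u := (w + U_(k) *+ (d - mdeg w))%MM.
have wT := std_supp stM Mw; have/eqP/mtrunc_idP w0 := wT.
have uk : mtrunc k u = w.
  rewrite -[RHS]wT; apply/mnmP => j; rewrite !mtruncE; case: ltnP => // jk.
  by rewrite mnmDE mulmnE mnm1E -val_eqE /= gtn_eqF ?addn0.
have du : mdeg u = d by rewrite mdegD mdegMn mdeg1 mul1n subnKC.
exists u => //; rewrite mem_filter mem_mons /extend uk du Mw lt_f leqnn eqxx !andbT.
apply/mtrunc_idP => j kj; rewrite mnmDE w0 ?(ltnW kj) //.
by rewrite mulmnE mnm1E -val_eqE /= ltn_eqF.
Qed.

Lemma extend_standard : standard_set k.+1 (extend k M f) f.
Proof.
split; [|exact: extend_divisor|exact: extend_revlex|exact: count_extend].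
by move=> u /and3P[/eqP].
Qed.
End Extend.

Lemma standard_set0 g : g 0 = 1 -> (forall d, g d.+1 = 0) ->
  standard_set 0 (pred1 0%MM) g.
Proof.
move=> g0 gS; have trunc0 u : mtrunc 0 u = 0%MM by apply/mnmP => i; rewrite !mnmE.
split=> [u /eqP->|u i|u v _ <- _ _ _|[|d]] /=; first exact: trunc0.
- by move/eqP/(congr1 mdeg)/eqP; rewrite mdegD mdeg1 addn1 mdeg0.
- by rewrite trunc0.
- rewrite g0 (eq_count (a2 := pred1 0%MM)); last first.
    by move=> u /=; case: eqP => // ->; rewrite mdeg0.
  by rewrite count_uniq_mem ?mons_uniq // mem_mons mdeg0.
rewrite gS (eq_count (a2 := pred0)) ?count_pred0 // => u /=.
by case: eqP => // ->; rewrite mdeg0.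
Qed.

(** The stage with k variables realises Delta^(n-k) h, so that each added variable undoes one
    difference. *)
Lemma exists_standard_set h : h 0 = 1 -> h 1 = n ->
  (forall k, k <= n -> unimodal (iter k Delta h)) ->
  exists M, standard_set n M h.
Proof.
move=> h0 h1 uni.
suff ex k : k <= n -> exists M, standard_set k M (iter (n - k) Delta h).
  by have [//|M] := ex n; rewrite subnn; exists M.
elim: k => [_|k IH kn].
  exists (pred1 0%MM); apply: standard_set0; first by rewrite iter_Delta0.
  have h10 : iter (n - 0) Delta h 1 = 0 by rewrite iter_Delta1 // h1; lia.
  have [p [incr decr]] := uni _ (leq_subr 0 n).
  (* A peak beyond 0 would require a strict increase to the value 0 in degree 1. With the peak at 0,
     all later values vanish. *)
  have p0 : p = 0.
    by case: p incr {decr} => // p /(_ 0 isT); rewrite h10.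
  by elim=> [//|d IH]; have := decr d.+1; rewrite p0 IH; lia.
have [M stM] := IH (ltnW kn).
exists (extend k M (iter (n - k.+1) Delta h)).
apply: (@extend_standard (Ordinal kn)).
  by rewrite /= -iterS subnSK.
by apply: uni; lia.
Qed.

End StandardMonomials.

Import GRing.Theory.
Local Open Scope ring_scope.

(** * Linear algebra modulo an ideal, and quotients by a linear form *)

Section Ideals.
Variables (K : fieldType) (m : nat).
Implicit Types (I J S V : {mpoly K[m]} -> Prop) (p q g : {mpoly K[m]}).

Lemma idealM I a p : is_ideal I -> I p -> I (a * p).
Proof. by case=> I0 II Ip; rewrite -[_ * _]addr0; apply: II. Qed.

Lemma idealD I p q : is_ideal I -> I p -> I q -> I (p + q).
Proof. by case=> I0 II Ip Iq; rewrite -[p]mul1r; apply: II. Qed.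

Lemma idealN I p : is_ideal I -> I p -> I (- p).
Proof. by move=> idI Ip; rewrite -mulN1r; apply: idealM. Qed.

Lemma idealB I p q : is_ideal I -> I p -> I q -> I (p - q).
Proof. by move=> idI Ip Iq; apply: idealD => //; apply: idealN. Qed.

Lemma idealZ I c p : is_ideal I -> I p -> I (c *: p).
Proof. by move=> idI Ip; rewrite -mul_mpolyC; apply: idealM. Qed.

Lemma ideal_sum I (T : Type) (r : seq T) (P : pred T) F :
  is_ideal I -> (forall i, P i -> I (F i)) -> I (\sum_(i <- r | P i) F i).
Proof.
by move=> idI IF; apply: (big_ind I) => //; [case: idI | move=> p q; apply: idealD].
Qed.

Lemma ideal_eqmod_trans I p q r :
  is_ideal I -> I (p - q) -> I (q - r) -> I (p - r).
Proof. by move=> idI Ipq Iqr; rewrite -(subrKA q p); apply: idealD. Qed.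

Lemma ideal_gen_min S J p :
  is_ideal J -> (forall q, S q -> J q) -> ideal_gen S p -> J p.
Proof.
move=> idJ SJ [r [a [g [Sg ->]]]].
by apply: ideal_sum => // i _; apply: idealM => //; apply: SJ.
Qed.

Lemma mem_ideal_gen S p : S p -> ideal_gen S p.
Proof.
move=> Sp; exists 1%N, (fun=> 1), (fun=> p); split=> //.
by rewrite big_ord1 mul1r.
Qed.

Lemma ideal_gen_ideal S : is_ideal (ideal_gen S).
Proof.
split; first by exists 0%N, (fun=> 0), (fun=> 0); split; [case | rewrite big_ord0].
move=> a p q [r1 [a1 [g1 [S1 ->]]]] [r2 [a2 [g2 [S2 ->]]]].
exists (r1 + r2)%N,
  (fun i => match split i with inl j => a * a1 j | inr j => a2 j end),
  (fun i => match split i with inl j => g1 j | inr j => g2 j end); split.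
  by move=> i; case: split.
rewrite big_split_ord mulr_sumr; congr (_ + _); apply: eq_bigr => i _.
  by rewrite (unsplitK (inl i)) mulrA.
by rewrite (unsplitK (inr i)).
Qed.

Definition lcomb d (e : 'I_d -> {mpoly K[m]}) (x : 'rV[K]_d) : {mpoly K[m]} :=
  \sum_i x 0 i *: e i.

Lemma lcombB d (e : 'I_d -> {mpoly K[m]}) x y :
  lcomb e (x - y) = lcomb e x - lcomb e y.
Proof. by rewrite /lcomb -sumrB; apply: eq_bigr => i _; rewrite !mxE scalerBl. Qed.

Lemma lcomb_mulmx d d' (e : 'I_d -> {mpoly K[m]}) (B : 'M_(d', d)) x :
  lcomb e (x *m B) = lcomb (fun i => lcomb e (row i B)) x.
Proof.
rewrite /lcomb; under [RHS]eq_bigr => i _ do rewrite scaler_sumr.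
rewrite exchange_big /=; apply: eq_bigr => j _.
rewrite !mxE scaler_suml; apply: eq_bigr => i _.
by rewrite !mxE scalerA.
Qed.

Definition subspace V := V 0 /\ forall (c : K) p q, V p -> V q -> V (c *: p + q).

Lemma subspace_homog d : subspace (fun p => p \is d.-homog).
Proof.
split=> [|c p q hp hq]; first exact: dhomog0.
by rewrite rpredD // rpredZ.
Qed.

Lemma subspace_lcomb V d (e : 'I_d -> {mpoly K[m]}) x :
  subspace V -> (forall i, V (e i)) -> V (lcomb e x).
Proof.
case=> V0 VD Ve; rewrite /lcomb; elim/big_rec: _ => // i p _ Vp.
exact: VD.
Qed.

(** Uniqueness and existence of coordinates are separated into independence and spanning, which
    suits matrix arguments. *)
Lemma dim_modP I V d : is_ideal I -> subspace V ->
  dim_mod I V d <->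
  exists e : 'I_d -> {mpoly K[m]}, [/\ forall i, V (e i),
    forall x, I (lcomb e x) -> x = 0 &
    forall p, V p -> exists x, I (p - lcomb e x)].
Proof.
move=> idI subV; split=> [[e [Ve ex1]]|[e [Ve indep span]]]; exists e; split=> //.
- move=> x Ix; have [y [_ uniq_y]] := ex1 _ (subspace_lcomb x subV Ve).
  rewrite -(uniq_y x) ?subrr; last by case: idI.
  by apply: uniq_y; rewrite [X in _ - X]big1 ?subr0 // => i _; rewrite mxE scale0r.
- by move=> p /ex1 [x [Ix _]]; exists x.
move=> p /span [x Ix]; exists x; split=> // y Iy.
apply/eqP; rewrite -subr_eq0; apply/eqP/indep; rewrite lcombB.
rewrite -(subrK p (lcomb e x)) -addrA -opprB addrC.
exact: (idealB idI).
Qed.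

Lemma dim_mod0 I V : is_ideal I -> subspace V ->
  dim_mod I V 0 <-> (forall p, V p -> I p).
Proof.
move=> idI subV; rewrite dim_modP //; split=> [[e [_ _ span]] p /span[x]|VI].
  by rewrite /lcomb big_ord0 subr0.
exists (fun=> 0); split=> [[]//|x _|p Vp]; first by rewrite thinmx0.
by exists 0; rewrite /lcomb big_ord0 subr0; apply: VI.
Qed.

Lemma dim_mod_sub0 I V d : is_ideal I -> subspace V ->
  dim_mod I V d -> (forall p, V p -> I p) -> d = 0%N.
Proof.
move=> idI subV; rewrite dim_modP // => -[e [Ve indep _]] VI.
case: d e Ve indep => // d e Ve indep.
have /matrixP/(_ 0 0) := indep (const_mx 1) (VI _ (subspace_lcomb _ subV Ve)).
by rewrite !mxE => /eqP; rewrite oner_eq0.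
Qed.

Lemma dim_mod_congr I J V d : (forall p, V p -> I p <-> J p) ->
  subspace V -> dim_mod I V d -> dim_mod J V d.
Proof.
move=> IJ subV [e [Ve ex1]]; exists e; split=> // p Vp.
have VB (c : 'rV[K]_d) : V (p - \sum_i c 0 i *: e i).
  have [_ VD] := subV.
  by rewrite addrC -scaleN1r; apply: VD => //; exact: (subspace_lcomb c subV Ve).
have [x [Ix uniq_x]] := ex1 _ Vp; exists x; split=> [|y Iy].
  by apply/IJ.
by apply: uniq_x; apply/IJ.
Qed.

Lemma pihomogM_linear g t p : g \is 1.-homog ->
  pihomog mdeg t.+1 (p * g) = pihomog mdeg t p * g.
Proof.
move=> hg; pose N := maxn t.+1 (msize p).
rewrite {1}(@pihomog_partitionE _ _ mdeg N p) ?leq_maxr //.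
rewrite mulr_suml linear_sum /=.
have tN : (t < N)%N by rewrite leq_max leqnn.
rewrite (bigD1 (Ordinal tN)) //= pihomog_dE; last first.
  by rewrite -addn1; apply: dhomogM => //; apply: pihomogP.
rewrite big1 ?addr0 // => i; rewrite -val_eqE /= => ne_it.
apply: (@pihomog_ne0 _ _ _ i.+1); first by rewrite eqSS.
by rewrite -addn1; apply: dhomogM => //; apply: pihomogP.
Qed.

Lemma pihomog0M_linear g p : g \is 1.-homog -> pihomog mdeg 0 (p * g) = 0.
Proof.
move=> hg; rewrite (@pihomog_partitionE _ _ mdeg (msize p) p) //.
rewrite mulr_suml linear_sum big1 //= => i _.
apply: (@pihomog_ne0 _ _ _ i.+1) => //.
by rewrite -addn1; apply: dhomogM => //; apply: pihomogP.
Qed.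

(** The ideal I + (g) with a single explicit multiplier, so that homogeneous components can be taken
    in it; [add_gensS] links it to [add_gens]. *)
Definition add_gen I g p := exists a, I (p - a * g).

Lemma add_gen_ideal I g : is_ideal I -> is_ideal (add_gen I g).
Proof.
move=> idI; split; first by exists 0; rewrite mul0r subr0; case: idI.
move=> a p q [b Ib] [c Ic]; exists (a * b + c).
rewrite mulrDl -mulrA opprD addrACA -mulrBr.
by case: idI => _; apply.
Qed.

Lemma add_gen_homogeneous I g :
  g \is 1.-homog -> homogeneous_ideal I -> homogeneous_ideal (add_gen I g).
Proof.
move=> hg [idI hI]; split=> [|p [|d] [a Ia]]; first exact: add_gen_ideal.
  exists 0; rewrite mul0r subr0 -[X in I X]subr0 -(pihomog0M_linear a hg).
  by rewrite -pihomogB; apply: hI.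
by exists (pihomog mdeg d a); rewrite -pihomogM_linear // -pihomogB; apply: hI.
Qed.

Lemma add_gen_homog I g d p : homogeneous_ideal I -> g \is 1.-homog ->
  p \is d.+1.-homog -> add_gen I g p ->
  exists2 q, q \is d.-homog & I (p - q * g).
Proof.
move=> [idI hI] hg hp [a Ia]; exists (pihomog mdeg d a); first exact: pihomogP.
by rewrite -pihomogM_linear // -{1}(pihomog_dE hp) -pihomogB; apply: hI.
Qed.

(** In degree t+1 the quotient is the cokernel of multiplication by [g] from degree t. In
    coordinates this is the quotient by the row space of a matrix [A], and a basis of the complement
    [A^C] gives a basis of it. *)
Lemma hilbert_add_gen I g h : homogeneous_ideal I -> g \is 1.-homog ->
  hilbert_function I h -> WLP I g -> hilbert_function (add_gen I g) (Delta h).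
Proof.
move=> hI hg HF wlp; have idI := hI.1.
have idJ := add_gen_ideal g idI.
case=> [|t] /=.
  (* A multiple of [g] has no component of degree 0, so nothing changes there. *)
  apply: dim_mod_congr (subspace_homog _) (HF 0%N) => p hp.
  split=> [Ip|[a Ia]]; first by exists 0; rewrite mul0r subr0.
  have := hI.2 _ 0%N Ia.
  by rewrite pihomogB pihomog0M_linear // subr0 pihomog_dE.
have /dim_modP[//||e [he ind_e span_e]] := HF t; first exact: subspace_homog.
have /dim_modP[//||e' [he' ind_e' span_e']] := HF t.+1; first exact: subspace_homog.
have hge i : e i * g \is t.+1.-homog by rewrite -addn1; apply: dhomogM.
have [r Ir] := fin_all_exists (fun i => span_e' _ (hge i)).
pose A := \matrix_i r i.
have Imul x : I (lcomb e x * g - lcomb e' (x *m A)).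
  rewrite lcomb_mulmx /lcomb mulr_suml -sumrB; apply: ideal_sum => // i _.
  by rewrite rowK -scalerAl -scalerBr; apply: idealZ.
have inJ y : add_gen I g (lcomb e' y) <-> (y <= A)%MS.
  split=> [Jy|/submxP[x ->]]; last first.
    by exists (lcomb e x); rewrite -opprB; apply: idealN.
  have hy := subspace_lcomb y (subspace_homog t.+1) he'.
  have [q hq Iq] := add_gen_homog hI hg hy Jy.
  have [x Ix] := span_e _ hq; apply/submxP; exists x.
  apply/eqP; rewrite -subr_eq0; apply/eqP/ind_e'; rewrite lcombB.
  apply: (ideal_eqmod_trans idI Iq); apply: (ideal_eqmod_trans idI _ (Imul x)).
  by rewrite -mulrBl mulrC; apply: idealM.
(* The WLP says that the matrix A of multiplication by g has maximal rank. *)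
have rkA : (h t.+1 - \rank A = h t.+1 - h t)%N.
  have [inj|surj] := wlp t.
    suff /eqP-> : row_free A by [].
    apply: inj_row_free => x xA0; apply/ind_e/inj.
      exact: subspace_lcomb (subspace_homog t) he.
    by have := Imul x; rewrite xA0 {2}/lcomb big1 ?subr0 1?mulrC // => i _;
       rewrite mxE scale0r.
  have rA := rank_leq_row A.
  suff Afull : row_full A by move: Afull rA => /eqP->; lia.
  rewrite -sub1mx; apply/row_subP => i; apply/inJ.
  have [|p _ Ip] := surj (lcomb e' (row i 1%:M)).
    by rewrite addn1; apply: subspace_lcomb (subspace_homog _) he'.
  by exists p; rewrite mulrC -[g]expr1.
rewrite -rkA -mxrank_compl.
apply/dim_modP => //; first exact: subspace_homog.
exists (fun i => lcomb e' (row i (row_base A^C)%MS)); split.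
- by move=> i; apply: subspace_lcomb (subspace_homog _) he'.
- move=> x; rewrite -lcomb_mulmx => /inJ xA.
  have : (x *m row_base A^C <= A :&: A^C)%MS.
    by rewrite sub_capmx xA (submx_trans (submxMl _ _)) ?eq_row_base.
  rewrite capmx_compl submx0 mulmx_free_eq0 ?row_base_free //; exact: eqP.
move=> p hp; have [y Iy] := span_e' _ hp.
have : (y <= A + A^C)%MS by rewrite submx_full ?addsmx_compl_full.
case/sub_addsmxP=> -[u v] /= Ey.
have /submxP[x Ex] : (v *m A^C <= row_base A^C)%MS.
  by rewrite eq_row_base submxMl.
exists x; rewrite -lcomb_mulmx -Ex.
apply: (ideal_eqmod_trans (q := lcomb e' y) idJ).
  by exists 0; rewrite mul0r subr0.
by rewrite -lcombB Ey addrK; apply/inJ; rewrite submxMl.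
Qed.

Lemma ideal_homogS I d : is_ideal I ->
  (forall p, p \is d.-homog -> I p) -> forall p, p \is d.+1.-homog -> I p.
Proof.
move=> idI Id p hp; rewrite [p]mpolyE big_seq; apply: ideal_sum => // u up.
apply: idealZ => //; have du : mdeg u = d.+1 := dhomog_mf hp up.
have [|i ui] := @mdeg_gt0_var _ u; first by rewrite du.
have le_iu : (U_(i) <= u)%MM by rewrite lep1mP.
rewrite -(submK le_iu) mpolyXD mulrC; apply: idealM => //; apply: Id.
rewrite dhomogX; apply/eqP; apply: succn_inj.
by rewrite -du -{2}(submK le_iu) mdegD mdeg1 addn1.
Qed.

Lemma hilbert_eq0S I h d : is_ideal I -> hilbert_function I h ->
  h d = 0%N -> h d.+1 = 0%N.
Proof.
move=> idI HF hd0; apply: dim_mod_sub0 (subspace_homog _) (HF d.+1) _ => //.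
have := HF d; rewrite hd0 dim_mod0 //; last exact: subspace_homog.
exact: ideal_homogS.
Qed.

(** Once h_(j+1) <= h_j, the Hilbert function [Delta h] of the quotient vanishes at j+1, hence at
    j+2, and [h] never rises again. The peak is the first index not followed by a rise. *)
Lemma WLP_unimodal I g h : homogeneous_ideal I -> g \is 1.-homog ->
  hilbert_function I h -> WLP I g -> (exists j, h j = 0%N) -> unimodal h.
Proof.
move=> hI hg HF wlp [z hz].
have step j : (h j.+1 <= h j)%N -> (h j.+2 <= h j.+1)%N.
  rewrite -!subn_eq0 => /eqP hj; apply/eqP.
  have HFg := hilbert_add_gen hI hg HF wlp.
  exact: (hilbert_eq0S (d := j.+1) (add_gen_ideal g hI.1) HFg hj).
have ex_peak : exists i, (h i.+1 <= h i)%N.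
  by exists z; rewrite (hilbert_eq0S hI.1 HF hz).
case: (ex_minnP ex_peak) => i hi min_i; exists i; split=> [j ji|j].
  by rewrite ltnNge; apply: contraTN ji => /min_i; rewrite -leqNgt.
elim: j => [|j IH]; first by rewrite leqn0 => /eqP<-.
by rewrite leq_eqVlt => /orP[/eqP<-//|/IH/step].
Qed.

Lemma add_gens0 I k (g : 'I_k -> {mpoly K[m]}) p :
  is_ideal I -> add_gens I g 0 p <-> I p.
Proof.
move=> idI; split; last by move=> Ip; apply: mem_ideal_gen; left.
by apply: ideal_gen_min => // q [//|[]].
Qed.

Lemma add_gensS I k (g : 'I_k -> {mpoly K[m]}) (i : 'I_k) p :
  add_gens I g i.+1 p <-> add_gen (add_gens I g i) (g i) p.
Proof.
have idi := ideal_gen_ideal; split.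
  apply: ideal_gen_min; first exact: add_gen_ideal (idi _).
  move=> q [Iq|[j]].
    by exists 0; rewrite mul0r subr0; apply: mem_ideal_gen; left.
  rewrite ltnS leq_eqVlt => /orP[/eqP/val_inj-> ->|lt_ji ->].
    by exists 1; rewrite mul1r subrr; exact: (idi _).1.
  by exists 0; rewrite mul0r subr0; apply: mem_ideal_gen; right; exists j.
case=> a Ia; rewrite -(subrK (a * g i) p); apply: (idealD (idi _)).
  apply: ideal_gen_min Ia => // q [Iq|[j lt_ji ->]];
    apply: mem_ideal_gen; first by left.
  by right; exists j => //; apply: ltnW.
by apply: idealM => //; apply: mem_ideal_gen; right; exists i.
Qed.
End Ideals.

(** * Iterated quotients by linear forms with the WLP *)

Section WeakLefschetz.
Variables (K : fieldType) (m : nat).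
Implicit Types I J : {mpoly K[m]} -> Prop.

Lemma homogeneous_congr I J : (forall p, I p <-> J p) ->
  homogeneous_ideal I -> homogeneous_ideal J.
Proof.
move=> IJ [[I0 IM] Ih]; split; [split; first exact/IJ|].
  by move=> a p q /IJ Ip /IJ Iq; apply/IJ/IM.
by move=> p d /IJ Ip; apply/IJ/Ih.
Qed.

Lemma hilbert_congr I J h : (forall p, I p <-> J p) ->
  hilbert_function I h -> hilbert_function J h.
Proof.
move=> IJ HF d.
exact: (dim_mod_congr (fun p _ => IJ p) (subspace_homog K m d) (HF d)).
Qed.

Lemma hilbert_add_gens I k (g : 'I_k -> {mpoly K[m]}) h :
  homogeneous_ideal I -> hilbert_function I h ->
  (forall i : 'I_k, g i \is 1.-homog /\ WLP (add_gens I g i) (g i)) ->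
  forall i, (i <= k)%N -> homogeneous_ideal (add_gens I g i) /\
    hilbert_function (add_gens I g i) (iter i Delta h).
Proof.
move=> hI HF gW; elim=> [_|i IH ik].
  have eqI p : I p <-> add_gens I g 0 p by rewrite add_gens0 //; exact: hI.1.
  by split; [apply: homogeneous_congr hI | apply: hilbert_congr HF].
have [hi HFi] := IH (ltnW ik).
have [g1 wlp] := gW (Ordinal ik); have eqI p := add_gensS I g (Ordinal ik) p.
split.
  by apply: homogeneous_congr (add_gen_homogeneous g1 hi) => p; rewrite eqI.
by apply: hilbert_congr (hilbert_add_gen hi g1 HFi wlp) => p; rewrite eqI.
Qed.

(** Below [h 1] the next linear form of the sequence gives unimodality. At k = [h 1] no form is
    left, but the difference is 0 in degree 1 and, as a Hilbert function, in every later degree. *)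
Lemma k_WLP_unimodal I (h : nat -> nat) :
  homogeneous_ideal I -> hilbert_function I h -> h 0%N = 1%N ->
  (exists z, forall j, (z <= j)%N -> h j = 0%N) -> k_WLP (h 1%N) I ->
  forall k, (k <= h 1%N)%N ->
  unimodal (iter k Delta h) /\ O_sequence K (iter k Delta h).
Proof.
move=> hI HF h0 [z hz] [g gW] k; have hg := hilbert_add_gens hI HF gW.
move=> le_kn; have [hk HFk] := hg _ le_kn; split; last by exists m, (add_gens I g k).
move: le_kn; rewrite leq_eqVlt => /orP[/eqP ek|lt_kn]; last first.
  have [g1 wlp] := gW (Ordinal lt_kn).
  by apply: WLP_unimodal g1 HFk wlp _ => //; exists z; apply: iter_Delta_eq0 hz _ _.
exists 0%N; split=> // j _.
suff E i : iter k Delta h i.+1 = 0%N by rewrite E.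
elim: i => [|i IH]; first by rewrite iter_Delta1 // ek subnn.
exact: (hilbert_eq0S hk.1 HFk IH).
Qed.
End WeakLefschetz.

(** Membership in an ideal is a [Prop], so listing the monomials outside it takes excluded
    middle. *)
Lemma classical_filter (T : eqType) (s : seq T) (P : T -> Prop) :
  exists2 r : seq T, uniq r & forall x, x \in r <-> x \in s /\ P x.
Proof.
elim: s => [|y s [r _ rP]]; first by exists [::] => // x; split=> // -[].
have [Py|nPy] := classic (P y).
  exists (undup (y :: r)) => [|x]; first exact: undup_uniq.
  rewrite mem_undup !inE; split=> [/orP[/eqP->|/rP[-> Px]]|[/orP[->//|xs] Px]].
  - by rewrite eqxx.
  - by rewrite orbT.
  by apply/orP; right; apply/rP.
exists (undup r) => [|x]; first exact: undup_uniq.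
rewrite mem_undup inE; split=> [/rP[-> Px]|[/orP[/eqP->//|xs] Px]].
  by rewrite orbT.
by apply/rP.
Qed.

(** * Monomial ideals, and the SLP of almost revlex ideals *)

Section MonomialIdeals.
Variables (K : fieldType) (n : nat).
Implicit Types (T S G : 'X_{1..n} -> Prop) (p q : {mpoly K[n]}) (u v w : 'X_{1..n}).

Definition up_closed T := forall u v, (u <= v)%MM -> T u -> T v.

(* A monomial ideal, or the space of forms of a given degree, according to T. *)
Definition mono_span T p := forall u, u \in msupp p -> T u.

Lemma mono_spanX T u : mono_span T 'X_[u] <-> T u.
Proof.
split=> [|Tu v]; first by apply; rewrite msuppX mem_seq1.
by rewrite msuppX mem_seq1 => /eqP->.
Qed.

Lemma mono_span_subspace T : subspace (mono_span T).
Proof.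
split=> [u|c p q Tp Tq u]; first by rewrite msupp0.
by move/msuppD_le; rewrite mem_cat => /orP[/msuppZ_le/Tp|/Tq].
Qed.

Lemma mono_span_ideal T : up_closed T -> is_ideal (mono_span T).
Proof.
move=> upT; split=> [u|a p q Tp Tq u]; first by rewrite msupp0.
move/msuppD_le; rewrite mem_cat => /orP[/msuppM_le|/Tq//].
case/allpairsP=> -[v w] /= [_ /Tp Tw ->]; apply: upT Tw.
exact: lem_addl.
Qed.

Lemma mono_span_terms T J p : is_ideal J ->
  (forall u, T u -> J 'X_[u]) -> mono_span T p -> J p.
Proof.
move=> idJ JX Tp; rewrite [p]mpolyE big_seq; apply: ideal_sum => // u /Tp Tu.
by apply: idealZ => //; apply: JX.
Qed.

Lemma mono_span_homogeneous T : up_closed T -> homogeneous_ideal (mono_span T).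
Proof.
move=> upT; have idT := mono_span_ideal upT; split=> // p d Tp.
rewrite pihomogE big_seq_cond; apply: ideal_sum => // u /andP[/Tp Tu _].
by apply: (idealZ _ idT); apply/mono_spanX.
Qed.

Lemma mcoeff_lcombX d (t : d.-tuple 'X_{1..n}) (x : 'rV[K]_d) i : uniq t ->
  (lcomb (fun j => 'X_[tnth t j]) x)@_(tnth t i) = x 0 i.
Proof.
move=> ut; rewrite linear_sum (bigD1 i) //= mcoeffZ mcoeffX eqxx mulr1.
rewrite big1 ?addr0 // => j ne_ji; rewrite mcoeffZ mcoeffX.
by rewrite (inj_eq (tuple_uniqP _ ut)) (negPf ne_ji) mulr0.
Qed.

Lemma mcoeff_lcombX0 d (t : d.-tuple 'X_{1..n}) (x : 'rV[K]_d) u : u \notin t ->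
  (lcomb (fun j => 'X_[tnth t j]) x)@_u = 0.
Proof.
move=> ut; rewrite linear_sum big1 //= => j _; rewrite mcoeffZ mcoeffX.
by case: eqP => [tu|_]; [rewrite -tu mem_tnth in ut | rewrite mulr0].
Qed.

(** The monomials in [S] but not in [T] form a basis: reduction drops the terms in [T], and the
    remaining coefficients are the coordinates. *)
Lemma dim_mod_mono T S (s : seq 'X_{1..n}) : up_closed T -> uniq s ->
  (forall u, u \in s <-> S u /\ ~ T u) ->
  dim_mod (mono_span T) (mono_span S) (size s).
Proof.
move=> upT us sP; have idT := mono_span_ideal upT.
apply/dim_modP => //; first exact: mono_span_subspace.
pose t := in_tuple s; exists (fun j => 'X_[tnth t j]); split.
- by move=> i; apply/mono_spanX; have /sP[] : tnth t i \in s by apply: mem_tnth.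
- move=> x Tx; apply/rowP => i; rewrite !mxE.
  apply/eqP/contraT => xi; have /sP[_ []] : tnth t i \in s by apply: mem_tnth.
  by apply: Tx; rewrite mcoeff_msupp mcoeff_lcombX.
move=> p Sp; exists (\row_i p@_(tnth t i)) => u.
rewrite mcoeff_msupp mcoeffB; have [ut|ut] := boolP (u \in t).
  by case/tnthP: ut => i ->; rewrite mcoeff_lcombX // mxE subrr eqxx.
rewrite mcoeff_lcombX0 // subr0 -mcoeff_msupp => /Sp Su; apply: NNPP => nTu.
by move/negP: ut; apply; apply/sP.
Qed.

Lemma mono_span_homog d p :
  p \is d.-homog <-> mono_span (fun u => mdeg u = d) p.
Proof. by split=> [/dhomogP|hp]; last exact/dhomogP. Qed.

Lemma dim_mod_congr_space I (V W : {mpoly K[n]} -> Prop) d :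
  (forall p, V p <-> W p) -> dim_mod I V d -> dim_mod I W d.
Proof.
move=> VW [e [Ve ex1]]; exists e; split=> [i|p /VW]; [exact/VW | exact: ex1].
Qed.

Lemma hilbert_mono T (h : nat -> nat) (s : nat -> seq 'X_{1..n}) : up_closed T ->
  (forall d, uniq (s d) /\ size (s d) = h d) ->
  (forall d u, u \in s d <-> mdeg u = d /\ ~ T u) ->
  hilbert_function (mono_span T) h.
Proof.
move=> upT sh sP d; have [us <-] := sh d.
apply: (dim_mod_congr_space (V := mono_span (fun u => mdeg u = d))).
  by move=> p; rewrite -mono_span_homog.
exact: dim_mod_mono.
Qed.

(** All monomials of degree at least [z] lie in the ideal, so only finitely many are standard. *)
Lemma artinian_mono T (h : nat -> nat) z : up_closed T ->
  hilbert_function (mono_span T) h -> h z = 0%N -> artinian (mono_span T).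
Proof.
move=> upT HF hz; have idT := mono_span_ideal upT.
have Tz u : (z <= mdeg u)%N -> T u.
  move/subnKC; move: (mdeg u - z)%N => k dk; apply/mono_spanX.
  have: 'X_[K, u] \is (mdeg u).-homog by rewrite dhomogX.
  rewrite -{}dk; elim: k 'X_[u] => [|k IH] p; last first.
    by rewrite addnS; apply: ideal_homogS.
  rewrite addn0; have := HF z; rewrite hz dim_mod0 //; last exact: subspace_homog.
  exact.
have [s us sP] := classical_filter [seq val u | u : 'X_{1..n < z}] (fun u => ~ T u).
exists (size s); apply: (dim_mod_congr_space (V := mono_span (fun=> True))) => [//|].
apply: dim_mod_mono => // u; rewrite sP; split=> [[_ ?]|[_ nTu]] //; split=> //.
have uz : (mdeg u < z)%N by rewrite ltnNge; apply/negP => /Tz.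
by apply/mapP; exists (BMultinom uz); rewrite ?mem_enum.
Qed.

Lemma mpolyXU_exp (k : 'I_n) s : ('X_k : {mpoly K[n]}) ^+ s = 'X_[U_(k) *+ s].
Proof. by rewrite mpolyXn. Qed.

Lemma lem_mnm1n (k : 'I_n) s v : (s <= v k)%N -> (U_(k) *+ s <= v)%MM.
Proof.
move=> sv; apply/mnm_lepP => j; rewrite mulmnE mnm1E.
by case: eqP => [<-|_]; rewrite ?mul1n.
Qed.

(** If the power of the variable kills no standard monomial of degree [i], multiplication is
    injective, as it keeps distinct monomials distinct. Otherwise every monomial of degree i+s is
    either in the ideal or divisible by that power. *)
Lemma mono_mul_full_rank T (k : 'I_n) s i : up_closed T ->
  (forall u v, mdeg u = i -> ~ T u -> T (u + U_(k) *+ s)%MM ->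
     mdeg v = (i + s)%N -> (v k < s)%N -> T v) ->
  mul_full_rank (mono_span T) 'X_k s i.
Proof.
move=> upT full; have idT := mono_span_ideal upT.
have [[u [du nTu Tus]]|inj] :=
  classic (exists u, [/\ mdeg u = i, ~ T u & T (u + U_(k) *+ s)%MM]); [right|left].
  move=> q /mono_span_homog hq.
  (* The preimage divides the divisible terms of [q]; the other terms lie in the ideal. *)
  exists (\sum_(v <- msupp q | (s <= v k)%N) q@_v *: 'X_[v - U_(k) *+ s]).
    apply/mono_span_homog; rewrite big_seq_cond.
    have [S0 SD] := mono_span_subspace (fun u : 'X_{1..n} => mdeg u = i).
    elim/big_rec: _ => // v p /andP[/hq dv sv]; apply: SD; apply/mono_spanX.
    have le_sv : (U_(k) *+ s <= v)%MM.
      exact: lem_mnm1n.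
    by apply: (@addIn s); rewrite -dv -{2}(submK le_sv) mdegD mdegMn mdeg1 mul1n.
  rewrite {1}[q]mpolyE (bigID (fun v : 'X_{1..n} => (s <= v k)%N)) /=.
  rewrite mulr_sumr addrC.
  rewrite -addrA -sumrB [X in _ + X]big1 ?addr0; last first.
    move=> v sv; rewrite mpolyXU_exp -scalerAr -mpolyXD addmC submK ?subrr //.
    exact: lem_mnm1n.
  rewrite big_seq_cond; apply: ideal_sum => // v /andP[/hq dv].
  rewrite -ltnNge => vs; apply: (idealZ _ idT); apply/mono_spanX.
  exact: full Tus dv vs.
move=> p /mono_span_homog hp Tp u up; apply: NNPP => nTu; apply: inj.
exists u; split=> //; first exact: hp; apply: Tp.
by rewrite mulrC mpolyXU_exp (perm_mem (msuppMX _ _)) addmC map_f.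
Qed.

Definition divisible_by G u := exists2 w, G w & (w <= u)%MM.

Lemma divisible_up_closed G : up_closed (divisible_by G).
Proof. by move=> u v uv [w Gw wu]; exists w => //; apply: lepm_trans uv. Qed.

Lemma ideal_gen_monomials G p :
  ideal_gen (fun q => exists2 u, G u & q = 'X_[u]) p <->
  mono_span (divisible_by G) p.
Proof.
split.
  apply: ideal_gen_min; first exact: mono_span_ideal (@divisible_up_closed G).
  by move=> _ [u Gu ->]; apply/mono_spanX; exists u => //; apply: lepm_refl.
apply: mono_span_terms (ideal_gen_ideal _) _ => u [w Gw wu].
rewrite -(submK wu) mpolyXD; apply: idealM (ideal_gen_ideal _) _.
by apply: mem_ideal_gen; exists w.
Qed.

Lemma exists_divisor d v : (d <= mdeg v)%N -> exists2 w, (w <= v)%MM & mdeg w = d.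
Proof.
move dv: (mdeg v) => e; elim: e v dv => [|e IH] v dv.
  by rewrite leqn0 => /eqP->; exists v => //; apply: lepm_refl.
rewrite leq_eqVlt => /orP[/eqP->|lt_de]; first by exists v => //; apply: lepm_refl.
have [|i vi] := @mdeg_gt0_var _ v; first by rewrite dv.
have le_iv : (U_(i) <= v)%MM by rewrite lep1mP.
have [|w wv dw] := IH (v - U_(i))%MM _ lt_de.
  by apply: succn_inj; rewrite -dv -{2}(submK le_iv) mdegD mdeg1 addn1.
by exists w => //; apply: lepm_trans wv _; apply: lem_subr.
Qed.

Lemma mdeg_bigD1 k u : mdeg u = (u k + \sum_(j < n | j != k) u j)%N.
Proof. by rewrite mdegE (bigD1 k). Qed.

(** Membership in the ideal of the variables after [k], which have already been factored out when
    ['X_k] acts. *)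
Definition has_var_above (k : 'I_n) u := exists2 j : 'I_n, (k < j)%N & u j != 0%N.

Lemma almost_revlex_full G (k : 'I_n) s u v :
  (forall w w', G w -> mdeg w' = mdeg w -> revlex_gt w' w -> divisible_by G w') ->
  ~ (divisible_by G u \/ has_var_above k u) ->
  divisible_by G (u + U_(k) *+ s)%MM \/ has_var_above k (u + U_(k) *+ s)%MM ->
  mdeg v = (mdeg u + s)%N -> (v k < s)%N ->
  divisible_by G v \/ has_var_above k v.
Proof.
move=> revG nTu Tus dv vs.
have us_ne j : j != k -> (u + U_(k) *+ s)%MM j = u j.
  by move=> ne; rewrite mnmDE mulmnE mnm1E eq_sym (negPf ne) addn0.
have us_k : (u + U_(k) *+ s)%MM k = (u k + s)%N.
  by rewrite mnmDE mulmnE mnm1E eqxx mul1n.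
have u0 (j : 'I_n) : (k < j)%N -> u j = 0%N.
  move=> kj; apply/eqP/negPn/negP => uj.
  by apply: nTu; right; exists j.
case: Tus => [[w Gw w_us]|[j kj]]; last first.
  by rewrite us_ne ?u0 // -val_eqE gtn_eqF.
have [v_above|v_above] := classic (has_var_above k v); [by right|left].
have v0 (j : 'I_n) : (k < j)%N -> v j = 0%N.
  by move=> kj; apply/eqP/negPn/negP => vj; apply: v_above; exists j.
have w_ne j : j != k -> (w j <= u j)%N.
  by move=> ne; rewrite -us_ne //; apply/mnm_lepP.
have w_k : (w k <= u k + s)%N by rewrite -us_k; apply/mnm_lepP.
(* Otherwise [w] would already divide [u]. *)
have u_w : (u k < w k)%N.
  rewrite ltnNge; apply/negP => wk; apply: nTu; left; exists w => //.
  by apply/mnm_lepP => j; have [->|/w_ne] := eqVneq j k.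
(* The largest divisor of v whose x_k-exponent is below that of w. *)
pose x : 'X_{1..n} := [multinom if j == k then minn (v k) (w k).-1 else v j | j < n].
have x_k : x k = minn (v k) (w k).-1 by rewrite mnmE eqxx.
have x_ne j : j != k -> x j = v j by move=> ne; rewrite mnmE (negPf ne).
have le_xv : (x <= v)%MM.
  by apply/mnm_lepP => j; have [->|/x_ne->//] := eqVneq j k; rewrite x_k geq_minl.
(* Degree count: if the cap is inactive, [x] is [v], whose degree is that of the multiple of [w]
   above. If not, the part of [v] without variable [k] has degree above that of [u], since v_k < s,
   and the exponent w_k - 1 makes up the rest. *)
have [|y yx dy] := @exists_divisor (mdeg w) x.
  have sum_w : (\sum_(j < n | j != k) w j <= \sum_(j < n | j != k) u j)%N.
    by apply: leq_sum => j /w_ne.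
  have sum_x : (\sum_(j < n | j != k) x j = \sum_(j < n | j != k) v j)%N.
    by apply: eq_bigr => j /x_ne.
  move: dv; rewrite !(mdeg_bigD1 k) sum_x x_k; lia.
have le_yv := lepm_trans yx le_xv.
apply: (divisible_up_closed le_yv); apply: (revG _ _ Gw dy); right; split=> //.
exists k; split=> [|j kj].
  by have := mnm_lepP yx k; rewrite x_k; lia.
have ne : j != k by rewrite -val_eqE gtn_eqF.
have := mnm_lepP le_yv j; have := w_ne _ ne.
by rewrite u0 ?v0 // !leqn0 => /eqP-> /eqP->.
Qed.

(** Through [rev_ord] the variables are factored out from the last one downwards, and the ideal
    stays monomial. *)
Lemma add_gens_vars (I : {mpoly K[n]} -> Prop) T (i : nat) p :
  up_closed T -> (forall q, I q <-> mono_span T q) ->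
  add_gens I (fun j : 'I_n => 'X_(rev_ord j)) i p <->
  mono_span (fun u => T u \/ exists2 j : 'I_n, (j < i)%N & u (rev_ord j) != 0%N) p.
Proof.
move=> upT IT; split.
  apply: ideal_gen_min.
    apply: mono_span_ideal => u v uv [Tu|[j ji uj]]; first by left; apply: upT Tu.
    right; exists j => //; rewrite -lt0n; apply: leq_trans (mnm_lepP uv _).
    by rewrite lt0n.
  move=> q [/IT Tq u /Tq|[j ji ->]]; first by left.
  by apply/mono_spanX; right; exists j => //; rewrite mnm1E eqxx.
apply: mono_span_terms (ideal_gen_ideal _) _ => u [Tu|[j ji uj]].
  by apply: mem_ideal_gen; left; apply/IT/mono_spanX.
have le_ju : (U_(rev_ord j) <= u)%MM by rewrite lep1mP.
rewrite -(submK le_ju) mpolyXD; apply: idealM (ideal_gen_ideal _) _.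
by apply: mem_ideal_gen; right; exists j.
Qed.

Lemma SLP_congr (I J : {mpoly K[n]} -> Prop) l :
  (forall p, I p <-> J p) -> SLP I l -> SLP J l.
Proof.
move=> IJ slp i s s0; have [inj|surj] := slp i s s0; [left|right].
  by move=> p hp /IJ Ip; apply/IJ/inj.
by move=> q /surj[p hp Ip]; exists p => //; apply/IJ.
Qed.

Lemma almost_revlex_k_SLP (I : {mpoly K[n]} -> Prop) : almost_revlex I -> k_SLP n I.
Proof.
case=> G [genG _] revG.
have GI p : I p <-> mono_span (divisible_by G) p by rewrite genG ideal_gen_monomials.
exists (fun j => 'X_(rev_ord j)) => i; split.
  by rewrite dhomogX /= mdeg1.
pose T u := divisible_by G u \/ has_var_above (rev_ord i) u.
have TI p : mono_span T p <-> add_gens I (fun j : 'I_n => 'X_(rev_ord j)) i p.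
  rewrite (add_gens_vars _ _ (@divisible_up_closed G) GI).
  split=> Tp u /Tp [Gu|[j ji uj]]; [by left|right|by left|right].
    exists (rev_ord j); last by rewrite rev_ordK.
    by move: ji (ltn_ord j) => /=; lia.
  by exists (rev_ord j) => //; move: ji (ltn_ord i) => /=; lia.
apply: SLP_congr TI _ => d s _; apply: mono_mul_full_rank.
  move=> u v uv [Gu|[j ji uj]]; first by left; apply: divisible_up_closed Gu.
  right; exists j => //; rewrite -lt0n; apply: leq_trans (mnm_lepP uv _).
  by rewrite lt0n.
move=> u v <-; apply: almost_revlex_full => w w' Gw dw /(revG _ _ Gw dw).
by move=> /GI/mono_spanX.
Qed.
End MonomialIdeals.

(** * The almost revlex ideal complementary to a standard set *)

Section StandardIdeal.
Variables (K : fieldType) (n : nat) (M : pred 'X_{1..n}) (h : nat -> nat).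
Hypothesis stM : standard_set n M h.

Let T (u : 'X_{1..n}) := ~~ M u.

Lemma nonstandard_up_closed : up_closed T.
Proof.
move=> u v uv; apply: contra; rewrite -(submK uv) addmC.
elim: {v uv}(mdeg (v - u)) {-2}(v - u)%MM (erefl (mdeg (v - u))) => [|d IH] w dw.
  by have /eqP := dw; rewrite mdeg_eq0 => /eqP->; rewrite addm0.
have [i wi] : exists i, w i != 0%N.
  by apply: mdeg_gt0_var; rewrite dw.
have le_iw : (U_(i) <= w)%MM by rewrite lep1mP.
rewrite -(submK le_iw) addmA => /(std_divisor stM); apply: IH.
by apply: succn_inj; rewrite -dw -{2}(submK le_iw) mdegD mdeg1 addn1.
Qed.

(** The minimal generators, phrased through divisors by one variable so that [std_revlex] applies to
    them directly. *)
Let G u := T u /\ forall w i, u = (w + U_(i))%MM -> M w.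

Lemma min_nonstandard_divides u : T u -> divisible_by G u.
Proof.
move du : (mdeg u) => d; elim: d u du => [|d IH] u du Tu.
  exists u; [split=> // w i uw | exact: lepm_refl].
  by move: du; rewrite uw mdegD mdeg1 addn1.
have [Gu|nGu] := classic (G u); first by exists u => //; apply: lepm_refl.
have [w [i [uw Tw]]] : exists w i, u = (w + U_(i))%MM /\ T w.
  apply: NNPP => nex; apply: nGu; split=> // w i uw.
  by apply/negPn/negP => Tw; apply: nex; exists w, i.
have [|v Gv vw] := IH w _ Tw.
  by apply: succn_inj; rewrite -du uw mdegD mdeg1 addn1.
by exists v => //; rewrite uw; apply: lepm_trans vw _; apply: lem_addr.
Qed.

Lemma nonstandard_almost_revlex : almost_revlex (mono_span T : {mpoly K[n]} -> Prop).
Proof.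
have TG u : T u <-> divisible_by G u.
  split=> [|[w [Tw _] wu]]; first exact: min_nonstandard_divides.
  exact: nonstandard_up_closed wu Tw.
exists G; first split.
- move=> p; rewrite ideal_gen_monomials.
  by split=> Tp u /Tp/TG.
- move=> G' subG genG' u [Tu div_u].
  have [w G'w wu] : divisible_by G' u.
    by apply/(mono_spanX K)/ideal_gen_monomials/genG'/mono_spanX.
  have [<-//|ne_wu] := eqVneq w u.
  have [Tw _] := subG _ G'w.
  have [i wi] : exists i, (u - w)%MM i != 0%N.
    apply: mdeg_gt0_var; rewrite lt0n mdeg_eq0; apply: contraNneq ne_wu => E.
    by rewrite -(submK wu) E add0m.
  have le_iuw : (U_(i) <= u - w)%MM by rewrite lep1mP.
  (* A proper divisor [w] of [u] from [G'] would also divide [u] with one variable removed, making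
     that monomial nonstandard, against [div_u]. *)
  have /div_u Mv : u = (u - w - U_(i) + w + U_(i))%MM.
    by rewrite -addmA [(w + _)%MM]addmC addmA !submK.
  have : T (u - w - U_(i) + w)%MM.
    by apply: nonstandard_up_closed Tw; apply: lem_addl.
  by rewrite /T Mv.
move=> u v [Tu div_u] dvu /revlex_ltP lt_uv; apply/mono_spanX.
apply: contra Tu => Mv.
exact: (std_revlex stM) Mv (mtrunc_n u) (esym dvu) lt_uv div_u.
Qed.

Lemma hilbert_nonstandard : hilbert_function (mono_span T : {mpoly K[n]} -> Prop) h.
Proof.
pose s d := [seq u <- mons n d | M u && (mdeg u == d)].
refine (@hilbert_mono K n T h s nonstandard_up_closed _ _) => [d|d u].
  by rewrite filter_uniq ?mons_uniq // size_filter (std_hilbert stM).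
rewrite mem_filter mem_mons /T; split=> [/andP[/andP[-> /eqP->]]//|[<- /negP]].
by rewrite negbK eqxx leqnn => ->.
Qed.
End StandardIdeal.

Lemma artinian_congr (K : fieldType) m (I J : {mpoly K[m]} -> Prop) :
  (forall p, I p <-> J p) -> artinian I -> artinian J.
Proof.
by move=> IJ [d dimI]; exists d; exact: dim_mod_congr (fun p _ => IJ p) _ dimI.
Qed.

Local Close Scope ring_scope.

(* tl = (h_2, ..., h_c) *)
Theorem proposition34 (K : fieldType) (charK : ([pchar K] =i pred0)%R)
    (n : nat) (tl : seq nat) (hpos : all (fun a => 0 < a) (n :: tl)) :
  let h : nat -> nat := nth 0 [:: 1, n & tl] in
  O_sequence K h ->
  [<-> exists I : {mpoly K[n]} -> Prop, almost_revlex I /\ hilbert_function I h;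
       exists (m : nat) (I : {mpoly K[m]} -> Prop),
         [/\ homogeneous_ideal I, artinian I, hilbert_function I h & k_SLP n I];
       exists (m : nat) (I : {mpoly K[m]} -> Prop),
         [/\ homogeneous_ideal I, artinian I, hilbert_function I h & k_WLP n I];
       (unimodal h /\ O_sequence K h) /\
       (forall k : nat, 1 <= k <= n ->
          unimodal (iter k Delta h) /\ O_sequence K (iter k Delta h))].

Proof.
move=> h Oh; have h0 : h 0 = 1 by [].
have h1 : h 1 = n by [].
have hz j : size [:: 1, n & tl] <= j -> h j = 0 by move=> /(nth_default 0).
tfae.
- case=> I [revI HF]; exists n, I; have kslp := almost_revlex_k_SLP revI.
  have [G [genG _] _] := revI.
  have IG p : mono_span (divisible_by G) p <-> I p.
    by rewrite genG ideal_gen_monomials.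
  have upG := @divisible_up_closed _ G.
  have HFG : hilbert_function (@mono_span K n (divisible_by G)) h.
    by apply: (hilbert_congr _ HF) => p; rewrite IG.
  split=> //.
    exact: homogeneous_congr IG (mono_span_homogeneous _ upG).
  (* The length of the list is c+1, the first degree where [h] takes the default value 0. *)
  exact: artinian_congr IG (artinian_mono upG HFG (hz _ (leqnn _))).
- case=> m [I [hI artI HF [g gS]]]; exists m, I; split=> //; exists g => i.
  by have [g1 slp] := gS i; split=> // j; apply: slp.
- case=> m [I [hI _ HF wlp]]; have uni := k_WLP_unimodal hI HF h0 _ wlp.
  have {}uni := uni (ex_intro _ _ hz).
  (* The case k = 0 is the claim on [h] itself. *)
  by split=> [|k /andP[_ kn]]; [exact: (uni 0) | exact: uni].
case=> -[uni_h _] uni.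
have [|M stM] := exists_standard_set h0 h1.
  by case=> [//|k kn]; case: (uni k.+1).
exists (mono_span (fun u => ~~ M u)); split.
  exact: nonstandard_almost_revlex stM.
exact: hilbert_nonstandard stM.
Qed.
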